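(* For every computable metric space $X$, $\mathrm{BWT}_X\equiv_{sW}\mathrm{K}_X'$.
   Context: A representation of a set $X$ is a surjective partial function $\delta:\subseteq\mathbb{N}^\mathbb{N}\to X$. For $f:\subseteq(X,\delta_X)\rightrightarrows(Y,\delta_Y)$ a realizer is a single-valued partial $F:\subseteq\mathbb{N}^\mathbb{N}\to\mathbb{N}^\mathbb{N}$ with $\delta_Y(F(p))\in f(\delta_X(p))$ for all $p\in\mathrm{dom}(f\circ\delta_X)$ ($F\vdash f$). $f\le_{sW}g$ iff there are computable partial $H,K$ on Baire space with $H\circ G\circ K\vdash f$ for every $G\vdash g$; $\equiv_{sW}$ is mutual reducibility. A computable metric space is $(X,d,\alpha)$ with $(X,d)$ a metric space, $\alpha:\mathbb{N}\to X$ with dense range and $(i,j)\mapsto d(\alpha(i),\alpha(j))$ computable; $X$ is represented by the Cauchy representation $\delta_X(p)=\lim_m\alpha(p(m))$ for $p$ with $d(\alpha(p(m)),\alpha(p(k)))<2^{-m}$ for all $k>m$, and $X^\mathbb{N}$ by $\langle p_0,p_1,\ldots\rangle\mapsto(\delta_X(p_0),\delta_X(p_1),\ldots)$ where $\langle p_0,p_1,\ldots\rangle(\langle i,j\rangle)=p_i(j)$ for a standard computable pairing. Compact subsets $K\subseteq X$ are represented by $\kappa_-$: a name of $K$ is a list (via a standard coding of finite sets) of all finite sets $\{B(\alpha(n_1),r_1),\ldots,B(\alpha(n_m),r_m)\}$ of open balls with non-negative rational radii $r_i$ whose union covers $K$. Compact choice $\mathrm{K}_X$ maps a non-empty compact set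 $K$ (given via $\kappa_-$) to any point of $K$. The Bolzano–Weierstraß map $\mathrm{BWT}_X:\subseteq X^\mathbb{N}\rightrightarrows X$ maps $(x_n)$ to the set of its cluster points, with domain the sequences whose range $\{x_n:n\in\mathbb{N}\}$ has compact closure. $\lim:\subseteq\mathbb{N}^\mathbb{N}\to\mathbb{N}^\mathbb{N}$ maps $\langle p_0,p_1,\ldots\rangle$ to $\lim_ip_i$ whenever it exists. The derivative $f'$ of $f:\subseteq(X,\delta)\rightrightarrows Y$ is the same function with input representation $\delta\circ\lim$ in place of $\delta$. *)

(* Defs.v *)
From HB Require Import structures.
From mathcomp Require Import all_boot all_order all_algebra.
From mathcomp Require Import all_classical all_reals all_analysis.
From Stdlib Require Cantor.

Set Implicit Arguments.
Unset Strict Implicit.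
Unset Printing Implicit Defensive.

Import Order.TTheory GRing.Theory Num.Theory.
Import numFieldNormedType.Exports.

Local Open Scope classical_set_scope.
Local Open Scope ring_scope.

Definition baire : Type := nat -> nat.

Definition npair (i j : nat) : nat := Cantor.to_nat (i, j).
Definition nfst (n : nat) : nat := (Cantor.of_nat n).1.
Definition nsnd (n : nat) : nat := (Cantor.of_nat n).2.

Lemma nfst_pair i j : nfst (npair i j) = i.
Proof. by rewrite /nfst /npair Cantor.cancel_of_to. Qed.

Lemma nsnd_pair i j : nsnd (npair i j) = j.
Proof. by rewrite /nsnd /npair Cantor.cancel_of_to. Qed.

Lemma npair_eta n : npair (nfst n) (nsnd n) = n.
Proof.
by rewrite /nfst /nsnd /npair -surjective_pairing Cantor.cancel_to_of.
Qed.

Record pfun (A B : Type) := PFun {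
  graph :> A -> B -> Prop;
  graph_functional : forall a b b', graph a b -> graph a b' -> b = b' }.

Lemma pcomp_functional (A B C : Type) (G : pfun B C) (F : pfun A B) a c c' :
  (exists2 b, F a b & G b c) -> (exists2 b, F a b & G b c') -> c = c'.
Proof.
move=> [b Fb Gc] [b' Fb' Gc'].
by move: Gc'; rewrite -(graph_functional Fb Fb'); exact: graph_functional.
Qed.

Definition pcomp (A B C : Type) (G : pfun B C) (F : pfun A B) : pfun A C :=
  PFun (@pcomp_functional A B C G F).

(* Partial recursive functions relative to an oracle. All functions are unary;
   several arguments are passed through the pairing [npair]. *)
Inductive code : Type :=
| cZero | cSucc | cFst | cSnd | cOracle
| cPair of code & code
| cComp of code & code
| cRec of code & code
| cMu of code.

(* [eval p e n m]: the computation of [e] with oracle [p] on input [n] halts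
   with value [m]. *)
Inductive eval (p : baire) : code -> nat -> nat -> Prop :=
| ev_zero n : eval p cZero n 0%N
| ev_succ n : eval p cSucc n n.+1
| ev_fst n : eval p cFst n (nfst n)
| ev_snd n : eval p cSnd n (nsnd n)
| ev_oracle n : eval p cOracle n (p n)
| ev_pair f g n a b : eval p f n a -> eval p g n b ->
    eval p (cPair f g) n (npair a b)
| ev_comp f g n a b : eval p g n a -> eval p f a b -> eval p (cComp f g) n b
| ev_rec0 f g a b : eval p f a b -> eval p (cRec f g) (npair a 0) b
| ev_recS f g a n r b : eval p (cRec f g) (npair a n) r ->
    eval p g (npair a (npair n r)) b -> eval p (cRec f g) (npair a n.+1) b
| ev_mu f a n (r : nat -> nat) : eval p f (npair a n) 0%N ->
    (forall m, (m < n)%N -> eval p f (npair a m) (r m).+1) ->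
    eval p (cMu f) a n.

(* As usual for partial functions on Baire space, nothing is required of the
   machine outside the domain of F. *)
Definition computable (F : pfun baire baire) : Prop :=
  exists e : code, forall p q, F p q -> forall n, eval p e n (q n).

Definition computable_nat (h : nat -> nat) : Prop :=
  exists e : code, forall p n, eval p e n (h n).

Record representation (X : Type) := Representation {
  repr :> pfun baire X;
  repr_surj : forall x, exists p, repr p x }.

Record repSpace := RepSpace {
  carrier :> Type;
  rep : representation carrier }.

(* Partial multi-valued functions; the domain consists of the points with a
   non-empty image. *)
Definition mvfun (X Y : repSpace) : Type := X -> set Y.

Definition mvdom (X Y : repSpace) (f : mvfun X Y) : set X :=
  [set x | f x !=set0].

Definition realizes (X Y : repSpace) (F : pfun baire baire) (f : mvfun X Y) :
    Prop :=
  forall p x, rep X p x -> mvdom f x ->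
    exists q y, [/\ F p q, rep Y q y & f x y].

Definition sW_le (X Y Z W : repSpace) (f : mvfun X Y) (g : mvfun Z W) : Prop :=
  exists H K : pfun baire baire, [/\ computable H, computable K &
    forall G : pfun baire baire, realizes G g ->
      realizes (pcomp H (pcomp G K)) f].

Definition sW_equiv (X Y Z W : repSpace) (f : mvfun X Y) (g : mvfun Z W) :
  Prop := sW_le f g /\ sW_le g f.

Definition component (p : baire) (i : nat) : baire := fun j => p (npair i j).

Lemma component_flatten (p : nat -> baire) i :
  component (fun n => p (nfst n) (nsnd n)) i = p i.
Proof. by apply/funext => j; rewrite /component nfst_pair nsnd_pair. Qed.

(* Convergence in Baire space: every coordinate is eventually constant. *)
Definition lim_graph (p q : baire) : Prop :=
  forall j, exists N, forall i, (N <= i)%N -> component p i j = q j.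

Lemma lim_functional p q q' : lim_graph p q -> lim_graph p q' -> q = q'.
Proof.
move=> pq pq'; apply/funext => j.
have [[N Nq] [N' Nq']] := (pq j, pq' j).
by rewrite -(Nq (maxn N N')) ?leq_maxl// Nq' ?leq_maxr.
Qed.

Definition limB : pfun baire baire := PFun lim_functional.

Lemma jump_surj (X : repSpace) (x : X) : exists p, pcomp (rep X) limB p x.
Proof.
have [q qx] := repr_surj (rep X) x.
exists (fun n => q (nsnd n)); exists q => // j; exists 0%N => i _.
by rewrite /component nsnd_pair.
Qed.

Definition jump (X : repSpace) : repSpace :=
  RepSpace (Representation (@jump_surj X)).

Definition derivative (X Y : repSpace) (f : mvfun X Y) : mvfun (jump X) Y := f.

Section SequenceSpace.
Variable X : repSpace.

Definition seq_graph (p : baire) (x : nat -> X) : Prop :=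
  forall i, rep X (component p i) (x i).

Lemma seq_functional p x x' : seq_graph p x -> seq_graph p x' -> x = x'.
Proof.
by move=> px px'; apply/funext => i; exact: graph_functional (px i) (px' i).
Qed.

Lemma seq_surj x : exists p, PFun seq_functional p x.
Proof.
have [p px] := choice (fun i => repr_surj (rep X) (x i)).
by exists (fun n => p (nfst n) (nsnd n)) => i; rewrite component_flatten.
Qed.

Definition seqSpace : repSpace := RepSpace (Representation seq_surj).

End SequenceSpace.

Section CauchyNames.
Variables (R : realType) (X : metricType R) (alpha : nat -> X).

Definition cauchy_graph (p : baire) (x : X) : Prop :=
  (forall m k, (m < k)%N -> mdist (alpha (p m)) (alpha (p k)) < 2 ^- m) /\
  alpha (p m) @[m --> \oo] --> x.

Lemma cauchy_functional p x x' :
  cauchy_graph p x -> cauchy_graph p x' -> x = x'.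
Proof.
by move=> [_ px] [_ px']; exact: (@cvg_unique _ (@metric_hausdorff R X)) px px'.
Qed.

Definition cauchyB : pfun baire X := PFun cauchy_functional.

Lemma cauchy_surj : dense (range alpha) -> forall x, exists p, cauchyB p x.
Proof.
move=> da x.
have : forall m : nat, exists n, mdist x (alpha n) < 2 ^- m.+1.
  move=> m; have e0 : 0 < (2 : R) ^- m.+1 by rewrite invr_gt0 exprn_gt0.
  have xb := nbhsx_ballx x _ e0.
  have [||y [/= yb [n _ ny]]] := da (ball x (2 ^- m.+1))^°.
  - by exists x; exact: xb.
  - exact: open_interior.
  exists n; have := interior_subset yb; rewrite -ny ballEmdist; exact.
move=> /choice[p hp]; exists p; split=> [m k mk|].
  rewrite (le_lt_trans (metric_triangle _ x _))// metric_sym.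
  rewrite (lt_le_trans (ltrD (hp m) (hp k)))//.
  have : (2 : R) ^- k.+1 <= 2 ^- m.+1.
    by rewrite lef_pV2 ?posrE ?exprn_gt0// ler_weXn2l ?ler1n// ltnS ltnW.
  move=> h; rewrite (le_trans (lerD (lexx _) h))//.
  by rewrite exprS invfM mulrC -splitr.
apply/metricType_numDomainType.cvgrPdist_lt => e e0.
have : (2^-1 : R) ^+ m @[m --> \oo] --> (0 : R).
  by apply: cvg_expr; rewrite ger0_norm// invf_lt1 ?ltr1n.
move=> /cvgrPdist_lt/(_ _ e0)[N _ hN]; exists N => // m Nm.
rewrite (lt_trans (hp m))//.
by have := hN m.+1 (leqW Nm); rewrite /= sub0r normrN exprVn ger0_norm.
Qed.

End CauchyNames.

(* Every code < a, < b, c > > stands for the rational (a - b) / (c + 1). *)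
Definition nuQ (n : nat) : rat :=
  ((nfst n)%:R - (nfst (nsnd n))%:R) / (nsnd (nsnd n)).+1%:R.

(* Computability of a map from nat to the reals, the latter with the Cauchy
   representation given by the dense sequence [nuQ]. *)
Definition computable_real_seq (R : realType) (u : nat -> R) : Prop :=
  exists2 h : nat -> nat, computable_nat h & forall n,
    @cauchyB R (R^o : metricType R) (fun k => ratr (nuQ k))
      (component h n) (u n).

Record computableMetricSpace (R : realType) := ComputableMetricSpace {
  cms_space :> metricType R;
  cms_dense : nat -> cms_space;
  cms_denseP : dense (range cms_dense);
  cms_computable : computable_real_seq
    (fun n => mdist (cms_dense (nfst n)) (cms_dense (nsnd n))) }.

Definition cauchySpace (R : realType) (X : computableMetricSpace R) :
    repSpace :=
  RepSpace (Representation (cauchy_surj (@cms_denseP R X))).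

(* A pair (n, r) stands for the open ball of centre alpha n and radius r; the
   code < n, < a, b > > for the ball (n, a / (b + 1)). *)
Definition fball_of (i : nat) : nat * rat :=
  (nfst i, (nfst (nsnd i))%:R / (nsnd (nsnd i)).+1%:R).

(* Canonical indices: c codes the set of the positions of the digits 1 in the
   binary expansion of c. *)
Definition fin_of (c : nat) : seq nat :=
  [seq i <- iota 0 c | odd (c %/ 2 ^ i)].

Definition fballs_of (c : nat) : seq (nat * rat) := map fball_of (fin_of c).

Lemma fin_of_surj (s : seq nat) : exists c, fin_of c =i s.
Proof.
have H n : exists2 c, (c < 2 ^ n)%N &
    forall i, odd (c %/ 2 ^ i) = (i < n)%N && (i \in s).
  elim: n => [|n [c cn IH]]; first by exists 0%N => // i; rewrite div0n.
  exists (c + (n \in s) * 2 ^ n)%N.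
    rewrite expnS mul2n -addnn -addSn leq_add//.
    by case: (n \in s); rewrite ?mul1n ?mul0n.
  move=> i; rewrite ltnS; case: (ltngtP i n) => [lin|lni|->].
  - rewrite -(subnK (ltnW lin)) expnD mulnA divnDMl ?expn_gt0// oddD IH lin/=.
    by rewrite oddM oddX subn_eq0 leqNgt lin/= andbF addbF.
  - rewrite divn_small//= (@leq_trans (2 ^ n.+1))%N ?leq_exp2l//.
    rewrite expnS mul2n -addnn -addSn leq_add//.
    by case: (n \in s); rewrite ?mul1n ?mul0n.
  - rewrite divnDMl ?expn_gt0// divn_small// add0n.
    by case: (n \in s).
have [c _ hc] := H (\max_(i <- s) i).+1%N; exists c => i.
rewrite mem_filter mem_iota/= add0n hc.
have [si|] := boolP (i \in s); last by rewrite andbF.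
have im : (i < (\max_(i <- s) i).+1)%N by rewrite ltnS leq_bigmax_seq.
rewrite im/=; have := hc i; rewrite im si/=; case: (ltnP i c) => // ci.
by rewrite divn_small// (leq_ltn_trans ci)// ltn_expl.
Qed.

Lemma fballs_of_surj (S : seq (nat * rat)) :
  all (fun b => 0 <= b.2) S -> exists c, fballs_of c =i S.
Proof.
move=> /allP S0.
have H b : exists i, b \in S -> fball_of i = b.
  have [/S0|] := boolP (b \in S); last by exists 0%N.
  case: b => n r /= r0; exists (npair n (npair `|numq r| `|denq r|.-1)) => _.
  rewrite /fball_of !(nfst_pair, nsnd_pair); congr pair.
  rewrite prednK ?absz_gt0// -[RHS]divq_num_den !pmulrn.
  by rewrite !gez0_abs// numq_ge0.
have [g hg] := choice H; have [c hc] := fin_of_surj (map g S).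
exists c => b; apply/mapP/idP => [[i + ->]|bS].
  by rewrite hc => /mapP[b' b'S ->]; rewrite hg.
by exists (g b); rewrite ?hg// hc map_f.
Qed.

Section CompactSets.
Variables (R : realType) (X : computableMetricSpace R).
Let alpha := @cms_dense R X.

Definition covers (S : seq (nat * rat)) (K : set X) : Prop :=
  K `<=` [set x | exists2 b, b \in S & ball (alpha b.1) (ratr b.2) x].

Definition compactSet : Type := {K : set X | compact K}.

(* Finite sets are lists up to [=i], i.e. up to having the same elements. *)
Definition kappa_graph (p : baire) (K : compactSet) : Prop :=
  forall S : seq (nat * rat), all (fun b => 0 <= b.2) S ->
    (covers S (sval K) <-> exists i, fballs_of (p i) =i S).

Lemma compact_fballs (K : set X) (P : nat * rat -> Prop) : compact K ->
  (forall x, K x -> exists b,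
     [/\ 0 <= b.2, P b & ball (alpha b.1) (ratr b.2) x]) ->
  exists S, [/\ all (fun b => 0 <= b.2) S, (forall b, b \in S -> P b) &
    covers S K].
Proof.
move=> cK KP; apply: contrapT => nS.
pose V : set (seq (nat * rat)) :=
  [set S | all (fun b => 0 <= b.2) S /\ forall b, b \in S -> P b].
pose U (S : seq (nat * rat)) : set X :=
  [set x | exists2 b, b \in S & ball (alpha b.1) (ratr b.2) x].
have V0 : V [::] by [].
have FF : ProperFilter (filter_from V (fun S => K `\` U S)).
  apply: filter_from_proper.
    apply: filter_from_filter; first by exists [::].
    move=> S S' [S0 SP] [S'0 S'P]; exists (S ++ S').
      split; first by rewrite all_cat S0.
      by move=> b; rewrite mem_cat => /orP[/SP|/S'P].
    move=> x [Kx nU]; split; split=> // -[b bS bx]; apply: nU;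
      by exists b => //; rewrite mem_cat bS ?orbT.
  move=> S [S0 SP]; apply: contrapT => nU; apply: nS; exists S; split=> //.
  by move=> x Kx; apply: contrapT => nUx; apply: nU; exists x.
have [|x [Kx clx]] := cK _ FF; first by exists [::] => // x [].
have [b [b0 Pb bx]] := KP x Kx.
have d0 : 0 < ratr b.2 - mdist (alpha b.1) x.
  by rewrite subr_gt0; move: bx; rewrite ballEmdist.
have Fb : filter_from V (fun S => K `\` U S) (K `\` U [:: b]).
  by exists [:: b] => //; split=> [|b']; rewrite ?inE ?all_seq1// => /eqP ->.
have [y [[_ nU] xy]] := clx _ _ Fb (nbhsx_ballx x _ d0).
apply: nU; exists b; first by rewrite inE.
by move: xy; rewrite !ballEmdist/= ltrBrDl; apply: le_lt_trans;
  exact: metric_triangle.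
Qed.

Lemma fball_near (x : X) (e : R) : 0 < e -> exists b : nat * rat,
  [/\ 0 <= b.2, ratr b.2 < e & ball (alpha b.1) (ratr b.2) x].
Proof.
move=> e0; have [q] := rat_in_itvoo e0; rewrite in_itv/= => /andP[q0 qe].
have [||y [/= yb [n _ ny]]] := @cms_denseP R X (ball x (ratr q))^°.
- by exists x; exact: nbhsx_ballx.
- exact: open_interior.
exists (n, q); split => //=; first by move: q0; rewrite ltr0q => /ltW.
by apply: ball_sym; have := interior_subset yb; rewrite -ny.
Qed.

Lemma kappa_functional p K L : kappa_graph p K -> kappa_graph p L -> K = L.
Proof.
suff H K' L' : kappa_graph p K' -> kappa_graph p L' -> sval K' `<=` sval L'.
  move=> pK pL; case: K L pK pL => [K cK] [L cL] pK pL.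
  have KL : K = L by apply/seteqP; split; [exact: H pK pL|exact: H pL pK].
  move: cK cL {pK pL}; rewrite KL => cK cL.
  by congr exist; exact: Prop_irrelevance.
move=> pK pL x Kx; apply: contrapT => Lx.
have [||S [S0 Sx SL]] := @compact_fballs (sval L')
    (fun b => ~ ball (alpha b.1) (ratr b.2) x); first exact: (svalP L').
- move=> y Ly; have xy : 0 < mdist x y / 2.
    rewrite divr_gt0// mdist_gt0; apply/eqP => xy; apply: Lx; rewrite xy//.
  have [b [b0 be by_]] := fball_near y xy; exists b; split=> // bx.
  have := ball_triangle (ball_sym bx) by_; rewrite ballEmdist/= => h.
  have := lt_trans h (ltrD be be); by rewrite -splitr ltxx.
have [b bS bx] := (pK S S0).2 ((pL S S0).1 SL) x Kx.
exact: Sx bx.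
Qed.

Lemma kappa_surj K : exists p, PFun kappa_functional p K.
Proof.
have [||S0 [S00 _ S0K]] := @compact_fballs (sval K) (fun=> True).
- exact: (svalP K).
- by move=> x _; have [b [? ? ?]] := fball_near x ltr01; exists b.
have [c0 hc0] := fballs_of_surj S00.
pose C c := `[< covers (fballs_of c) (sval K) >].
have cov S S' : S =i S' -> covers S (sval K) -> covers S' (sval K).
  by move=> SS' h x /h[b bS bx]; exists b => //; rewrite -SS'.
exists (fun i => if C i then i else c0) => S S_ge0; split.
  have [c hc] := fballs_of_surj S_ge0.
  move=> SK; exists c; rewrite ifT//; apply/asboolP; apply: cov SK => b.
  by rewrite hc.
move=> [i]; case: ifP => [/asboolP Ci|_] h; first exact: cov Ci.
by apply: cov S0K => b; rewrite -hc0.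
Qed.

Definition compactSpace : repSpace :=
  RepSpace (Representation kappa_surj).

Definition compactChoice : mvfun compactSpace (cauchySpace X) :=
  fun K : compactSet => sval K.

Definition BWT : mvfun (seqSpace (cauchySpace X)) (cauchySpace X) :=
  fun x : nat -> X =>
    [set y | compact (closure (range x)) /\ cluster (x n @[n --> \oo]) y].

Lemma mvdom_BWT : mvdom BWT = [set x : nat -> X | compact (closure (range x))].
Proof.
apply/seteqP; split=> x /=; first by move=> [y []].
move=> cx; have [|y [_ xy]] := cx (x n @[n --> \oo]) _.
  by exists 0%N => // n _; apply: subset_closure; exists n.
by exists y.
Qed.

End CompactSets.

Arguments compactChoice {R} X K _.
Arguments BWT {R} X x _.

(* Main.v *)
From mathcomp Require Import all_boot all_order all_algebra.
From mathcomp Require Import all_classical all_reals all_analysis.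
From mathcomp Require Import ring lra.
Require Import Defs.

(** Both reductions translate only the input; the outer functional is the
    identity.

    For BWT <= K', the set [K] of cluster points of a sequence [x] with compact
    range closure is compact, and a finite union of balls covers [K] iff, for
    some [n], all [x i] with [i >= n] lie in one of these balls with a margin of
    order [1 / (n + 1)].  With rational approximations of the distances this is
    a decidable condition on [(n, i)], so the covers of [K] form a Sigma_2 set,
    and such a set has an enumeration that is computable in the limit.

    For K' <= BWT, at stage [t] one picks a dense point [a <= t] that, up to
    precision [t], lies in as many initial members as possible of the [t]-th
    approximation of the list of covers of [K].  These points are eventually in
    every cover of [K]; hence their range has compact closure and all their
    cluster points belong to [K]. *)

Set Implicit Arguments.
Unset Strict Implicit.
Unset Printing Implicit Defensive.

Import Order.TTheory GRing.Theory Num.Theory.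
Import numFieldNormedType.Exports.

Local Open Scope classical_set_scope.
Local Open Scope nat_scope.

(** * Bounded search and operations computable with an oracle *)

Lemma find_iota_min (P : pred nat) m N : m < N -> P m ->
  (forall k, k < m -> ~~ P k) -> find P (iota 0 N) = m.
Proof.
move=> mN Pm nP.
have hP : has P (iota 0 N) by apply/hasP; exists m; rewrite ?mem_iota.
have := hP; rewrite has_find size_iota => fN.
have := nth_find 0 hP; rewrite nth_iota// add0n => Pf.
case: (ltngtP (find P (iota 0 N)) m) => // [/nP|mf]; first by rewrite Pf.
by have := before_find 0 mf; rewrite nth_iota// add0n Pm.
Qed.

(** Only total operations are considered, so the closure properties below carry no domain
    conditions. *)
Definition computable_op (F : baire -> nat -> nat) : Prop :=
  exists e : code, forall p n, eval p e n (F p n).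

Definition total_pfun (F : baire -> baire) : pfun baire baire :=
  PFun (fun p q q' (Fq : q = F p) (Fq' : q' = F p) => etrans Fq (esym Fq')).

Lemma computable_total (F : baire -> baire) : computable_op F ->
  computable (total_pfun F).
Proof. by move=> [e he]; exists e => p q -> n. Qed.

Lemma computable_op_const c : computable_op (fun _ _ => c).
Proof.
elim: c => [|c [e he]]; first by exists cZero => p n; constructor.
by exists (cComp cSucc e) => p n; apply: ev_comp (he p n) _; constructor.
Qed.

Lemma computable_op_id : computable_op (fun _ n => n).
Proof.
exists (cPair cFst cSnd) => p n; rewrite -{2}[n]npair_eta.
by apply: ev_pair; constructor.
Qed.

Lemma computable_op_comp F G : computable_op F -> computable_op G ->
  computable_op (fun p n => G p (F p n)).
Proof.
by move=> [e he] [f hf]; exists (cComp f e) => p n; apply: ev_comp (he p n) _.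
Qed.

Lemma computable_op_nat h F : computable_nat h -> computable_op F ->
  computable_op (fun p n => h (F p n)).
Proof.
by move=> [e he] cF; apply: (computable_op_comp cF (G := fun=> h)); exists e.
Qed.

Lemma computable_op_fst F : computable_op F ->
  computable_op (fun p n => nfst (F p n)).
Proof.
by apply: (computable_op_nat (h := nfst)); exists cFst; constructor.
Qed.

Lemma computable_op_snd F : computable_op F ->
  computable_op (fun p n => nsnd (F p n)).
Proof.
by apply: (computable_op_nat (h := nsnd)); exists cSnd; constructor.
Qed.

Lemma computable_op_succ F : computable_op F ->
  computable_op (fun p n => (F p n).+1).
Proof.
by apply: (computable_op_nat (h := succn)); exists cSucc; constructor.
Qed.

Lemma computable_op_oracle F : computable_op F ->
  computable_op (fun p n => p (F p n)).
Proof.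
move=> cF; apply: (computable_op_comp cF (G := fun p n => p n)).
by exists cOracle; constructor.
Qed.

Lemma computable_op_pair F G : computable_op F -> computable_op G ->
  computable_op (fun p n => npair (F p n) (G p n)).
Proof. by move=> [e he] [f hf]; exists (cPair e f) => p n; constructor. Qed.

(** The packing [<n, <k, r>>] of input, counter and accumulator is the one in which [cRec] calls its
    step function. *)
Lemma computable_op_iteri N F G : computable_op N -> computable_op F ->
  computable_op (fun p z => G p (nfst z) (nfst (nsnd z)) (nsnd (nsnd z))) ->
  computable_op (fun p n => iteri (N p n) (G p n) (F p n)).
Proof.
move=> [eN hN] [f hf] [g hg].
exists (cComp (cRec f g) (cPair (cPair cFst cSnd) eN)) => p n.
apply: (@ev_comp _ _ _ _ (npair n (N p n))).
  by apply: ev_pair (hN p n); rewrite -{2}[n]npair_eta; apply: ev_pair;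
    constructor.
elim: (N p n) => [|k IH] /=; first exact: ev_rec0.
apply: ev_recS IH _; set r := iteri _ _ _.
by have := hg p (npair n (npair k r)); rewrite !(nfst_pair, nsnd_pair).
Qed.

Lemma computable_op_add F G : computable_op F -> computable_op G ->
  computable_op (fun p n => F p n + G p n).
Proof.
move=> cF cG; rewrite [X in computable_op X](_ : _ =
  fun p n => iteri (G p n) (fun _ r => r.+1) (F p n)).
  apply: (computable_op_iteri (G := fun _ _ _ r => r.+1)) => //.
  by do 3!(apply: computable_op_succ || apply: computable_op_snd);
    exact: computable_op_id.
apply/funext => p; apply/funext => n.
by elim: (G p n) => [|k IH] /=; rewrite ?addn0// addnS IH.
Qed.

Lemma computable_op_mul F G : computable_op F -> computable_op G ->
  computable_op (fun p n => F p n * G p n).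
Proof.
move=> cF cG; rewrite [X in computable_op X](_ : _ =
  fun p n => iteri (G p n) (fun _ r => F p n + r) 0).
  apply: (computable_op_iteri (G := fun p n _ r => F p n + r)) => //.
    exact: computable_op_const.
  apply: computable_op_add.
    apply: (computable_op_comp (F := fun _ z => nfst z)) => //.
    exact: computable_op_fst computable_op_id.
  by do 2!apply: computable_op_snd; exact: computable_op_id.
apply/funext => p; apply/funext => n.
by elim: (G p n) => [|k IH] /=; rewrite ?muln0// mulnS IH.
Qed.

Lemma computable_op_sub F G : computable_op F -> computable_op G ->
  computable_op (fun p n => F p n - G p n).
Proof.
have cpred H : computable_op H -> computable_op (fun p n => (H p n).-1).
  move=> cH; rewrite [X in computable_op X](_ : _ =
    fun p n => iteri (H p n) (fun k _ => k) 0); last first.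
    by apply/funext => p; apply/funext => n; case: (H p n).
  apply: (computable_op_iteri (G := fun _ _ k _ => k)) => //.
    exact: computable_op_const.
  exact: computable_op_fst (computable_op_snd computable_op_id).
move=> cF cG; rewrite [X in computable_op X](_ : _ =
  fun p n => iteri (G p n) (fun _ r => r.-1) (F p n)).
  apply: (computable_op_iteri (G := fun _ _ _ r => r.-1)) => //.
  by apply: cpred; do 2!apply: computable_op_snd; exact: computable_op_id.
apply/funext => p; apply/funext => n.
by elim: (G p n) => [|k IH] /=; rewrite ?subn0// subnS IH.
Qed.

Lemma computable_op_if B F G :
  computable_op (fun p n => B p n : bool) -> computable_op F ->
  computable_op G -> computable_op (fun p n => if B p n then F p n else G p n).
Proof.
move=> cB cF cG; rewrite [X in computable_op X](_ : _ =
  fun p n => iteri (B p n) (fun _ _ => F p n) (G p n)); last first.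
  by apply/funext => p; apply/funext => n; case: (B p n).
apply: (computable_op_iteri (G := fun p n _ _ => F p n)) => //.
apply: (computable_op_comp (F := fun _ z => nfst z)) => //.
exact: computable_op_fst computable_op_id.
Qed.

Lemma computable_op_leq F G : computable_op F -> computable_op G ->
  computable_op (fun p n => F p n <= G p n).
Proof.
move=> cF cG; rewrite [X in computable_op X](_ : _ =
  fun p n => 1 - (F p n - G p n)).
  apply: computable_op_sub; first exact: computable_op_const.
  exact: computable_op_sub.
by apply/funext => p; apply/funext => n; rewrite /leq; case: (F p n - G p n).
Qed.

Lemma computable_op_neg B : computable_op (fun p n => B p n : bool) ->
  computable_op (fun p n => ~~ B p n).
Proof.
move=> cB; rewrite [X in computable_op X](_ : _ =
  fun p n => if B p n then 0 else 1).
  by apply: computable_op_if => //; exact: computable_op_const.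
by apply/funext => p; apply/funext => n; case: (B p n).
Qed.

Lemma computable_op_and B C : computable_op (fun p n => B p n : bool) ->
  computable_op (fun p n => C p n : bool) ->
  computable_op (fun p n => B p n && C p n).
Proof.
move=> cB cC; rewrite [X in computable_op X](_ : _ =
  fun p n => if B p n then nat_of_bool (C p n) else 0).
  by apply: computable_op_if => //; exact: computable_op_const.
by apply/funext => p; apply/funext => n; case: (B p n).
Qed.

Lemma computable_op_find N B : computable_op N ->
  computable_op (fun p z => B p (nfst z) (nsnd z) : bool) ->
  computable_op (fun p n => find (B p n) (iota 0 (N p n))).
Proof.
(* After [k] rounds, [r] is the first hit below [k], or [k] if there is none; so [r < k] means that
   the search has already succeeded. *)
move=> cN cB; rewrite [X in computable_op X](_ : _ = fun p n => iteri (N p n)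
  (fun k r => if r < k then r else k + ~~ B p n k) 0).
  have cr : computable_op (fun _ z => nsnd (nsnd z)).
    by do 2!apply: computable_op_snd; exact: computable_op_id.
  have ck : computable_op (fun _ z => nfst (nsnd z)).
    exact: computable_op_fst (computable_op_snd computable_op_id).
  apply: (computable_op_iteri
    (G := fun p n k r => if r < k then r else k + ~~ B p n k)) => //.
    exact: computable_op_const.
  apply: computable_op_if => //.
    by apply: computable_op_leq => //; exact: computable_op_succ.
  apply: computable_op_add => //; apply: computable_op_neg.
  have cnk : computable_op (fun _ z => npair (nfst z) (nfst (nsnd z))).
    apply: computable_op_pair => //.
    exact: computable_op_fst computable_op_id.
  have := computable_op_comp cnk cB; congr computable_op.
  by apply/funext => p; apply/funext => z; rewrite nfst_pair nsnd_pair.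
apply/funext => p; apply/funext => n; elim: (N p n) => // k IH.
rewrite -addn1 iotaD find_cat has_find size_iota add0n addn1 /= -IH.
by case: ifP => // _; case: (B p n k).
Qed.

Lemma computable_op_has N B : computable_op N ->
  computable_op (fun p z => B p (nfst z) (nsnd z) : bool) ->
  computable_op (fun p n => has (B p n) (iota 0 (N p n))).
Proof.
move=> cN cB; rewrite [X in computable_op X](_ : _ =
  fun p n => nat_of_bool (find (B p n) (iota 0 (N p n)) < N p n)).
  apply: computable_op_leq => //.
  by apply: computable_op_succ; exact: computable_op_find.
by apply/funext => p; apply/funext => n; rewrite has_find size_iota.
Qed.

Lemma computable_op_all N B : computable_op N ->
  computable_op (fun p z => B p (nfst z) (nsnd z) : bool) ->
  computable_op (fun p n => all (B p n) (iota 0 (N p n))).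
Proof.
move=> cN cB; rewrite [X in computable_op X](_ : _ =
  fun p n => nat_of_bool (~~ has (fun k => ~~ B p n k) (iota 0 (N p n)))).
  apply: computable_op_neg.
  apply: (computable_op_has (B := fun p n k => ~~ B p n k)) => //.
  exact: computable_op_neg.
apply/funext => p; apply/funext => n; rewrite -all_predC.
by congr (nat_of_bool _); apply: eq_all => k /=; rewrite negbK.
Qed.

(** Needed to decode canonical indices. Parity comes from iterating [1 - r], halving from counting
    the odd numbers below [r]. *)
Lemma computable_op_bit F G : computable_op F -> computable_op G ->
  computable_op (fun p n => odd (F p n %/ 2 ^ G p n)).
Proof.
have codd H : computable_op H -> computable_op (fun p n => odd (H p n)).
  move=> cH; rewrite [X in computable_op X](_ : _ =
    fun p n => iteri (H p n) (fun _ r => 1 - r) 0).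
    apply: (computable_op_iteri (G := fun _ _ _ r => 1 - r)) => //.
      exact: computable_op_const.
    apply: computable_op_sub; first exact: computable_op_const.
    by do 2!apply: computable_op_snd; exact: computable_op_id.
  apply/funext => p; apply/funext => n.
  by elim: (H p n) => //= k <-; case: (odd k).
move=> cF cG; apply: (codd); rewrite [X in computable_op X](_ : _ =
  fun p n => iteri (G p n)
    (fun _ r => iteri r (fun k s => s + odd k) 0) (F p n)).
  apply: (computable_op_iteri
    (G := fun _ _ _ r => iteri r (fun k s => s + odd k) 0)) => //.
  apply: (computable_op_iteri (G := fun _ _ k s => s + odd k)).
  - by do 2!apply: computable_op_snd; exact: computable_op_id.
  - exact: computable_op_const.
  apply: computable_op_add.
    by do 2!apply: computable_op_snd; exact: computable_op_id.
  by apply: codd; exact: computable_op_fst (computable_op_snd computable_op_id).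
apply/funext => p; apply/funext => n.
have half_iteri m : iteri m (fun k s => s + odd k) 0 = m./2.
  by elim: m => //= m ->; rewrite uphalf_half addnC.
elim: (G p n) => [|k IH]; first by rewrite divn1.
by rewrite /= -IH half_iteri -divn2 -divnMA -expnSr.
Qed.

(* The rule is chosen by the head symbol: plain [apply] would unfold the
   arithmetic operations while unifying. *)
Ltac computable_op_step :=
  lazymatch goal with
  | |- computable_op (fun _ n => n) => exact: computable_op_id
  | |- computable_op (fun _ _ => ?c) => exact: computable_op_const
  | |- computable_op (fun p n => (@?F p n).+1) =>
      apply: (@computable_op_succ F)
  | |- computable_op (fun p n => nfst (@?F p n)) =>
      apply: (@computable_op_fst F)
  | |- computable_op (fun p n => nsnd (@?F p n)) =>
      apply: (@computable_op_snd F)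
  | |- computable_op (fun p n => p (@?F p n)) =>
      apply: (@computable_op_oracle F)
  | |- computable_op (fun p n => nat_of_bool (~~ @?B p n)) =>
      apply: (@computable_op_neg B)
  | |- computable_op (fun p n => nat_of_bool (@?B p n && @?C p n)) =>
      apply: (@computable_op_and B C)
  | |- computable_op (fun p n => nat_of_bool (odd (@?F p n %/ 2 ^ @?G p n))) =>
      apply: (@computable_op_bit F G)
  | |- computable_op (fun p n => npair (@?F p n) (@?G p n)) =>
      apply: (@computable_op_pair F G)
  | |- computable_op (fun p n => @?F p n + @?G p n) =>
      apply: (@computable_op_add F G)
  | |- computable_op (fun p n => @?F p n - @?G p n) =>
      apply: (@computable_op_sub F G)
  | |- computable_op (fun p n => @?F p n * @?G p n) =>
      apply: (@computable_op_mul F G)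
  | |- computable_op (fun p n => nat_of_bool (@?F p n <= @?G p n)) =>
      apply: (@computable_op_leq F G)
  | |- computable_op (fun p n => find (@?B p n) (iota 0 (@?N p n))) =>
      apply: (@computable_op_find N B)
  | |- computable_op
         (fun p n => nat_of_bool (has (@?B p n) (iota 0 (@?N p n)))) =>
      apply: (@computable_op_has N B)
  | |- computable_op
         (fun p n => nat_of_bool (all (@?B p n) (iota 0 (@?N p n)))) =>
      apply: (@computable_op_all N B)
  end.

(** * A decidable margin test for rational balls *)

Section InBall.
Variable h : nat -> nat.

(* [(a - b) / (c + 1) + 1 / (n + 1) < u / (v + 1)] with the denominators
   cleared, where the left fraction is the approximation with index [n + 2] of
   the distance from the point [i] to the centre of the ball [j], and
   [u / (v + 1)] is the radius of this ball. *)
Definition inball (n i j : nat) : bool :=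
  let q := h (npair (npair i (nfst j)) n.+2) in
  let u := nfst (nsnd j) in let v := nsnd (nsnd j) in
  nfst q * n.+1 * v.+1 + (nsnd (nsnd q)).+1 * v.+1 <
  u * (nsnd (nsnd q)).+1 * n.+1 + nfst (nsnd q) * n.+1 * v.+1.

Definition incover (n i c : nat) : bool :=
  has (fun j => odd (c %/ 2 ^ j) && inball n i j) (iota 0 c).

Lemma incoverP n i c : reflect (exists2 j, j \in fin_of c & inball n i j)
  (incover n i c).
Proof.
apply: (iffP hasP) => -[j].
  by move=> jc /andP[oj ij]; exists j => //; rewrite mem_filter oj.
by rewrite mem_filter => /andP[oj jc] ij; exists j => //; rewrite oj.
Qed.

Lemma computable_op_incover N I C : computable_nat h ->
  computable_op N -> computable_op I -> computable_op C ->
  computable_op (fun p n => incover (N p n) (I p n) (C p n)).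
Proof.
move=> ch cN cI cC; apply: (computable_op_has
  (B := fun p n j => odd (C p n %/ 2 ^ j) && inball (N p n) (I p n) j)) => //.
have cfst F : computable_op F -> computable_op (fun p z => F p (nfst z)).
  by apply: computable_op_comp; exact: computable_op_fst computable_op_id.
have ch' F : computable_op F -> computable_op (fun p n => h (F p n)).
  exact: computable_op_nat.
rewrite /inball; repeat first
  [ exact: cfst cN | exact: cfst cI | exact: cfst cC
  | computable_op_step | apply: ch' ].
Qed.
End InBall.

(** * Finite ball covers, attracted sequences and cluster sets *)

Local Open Scope ring_scope.

Lemma filter_forall_in (T : eqType) (U : Type) (F : set_system U) (s : seq T)
  (P : T -> U -> Prop) : Filter F -> (forall b, b \in s -> F (P b)) ->
  F (fun u => forall b, b \in s -> P b u).
Proof.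
move=> FF; elim: s => [|b s IH] sP; first exact: filterS filterT.
apply: filterS2 (sP b _) (IH _); last 2 first.
- exact: mem_head.
- by move=> c cs; apply: sP; rewrite inE cs orbT.
by move=> u Pb Ps c; rewrite inE => /orP[/eqP ->|/Ps].
Qed.

Section Topology.
Variables (R : realType) (X : computableMetricSpace R).
Notation alpha := (@cms_dense R X).
Implicit Types (K : set X) (x : nat -> X) (S : seq (nat * rat)).

Definition ball_union S : set X :=
  [set x | exists2 b, b \in S & ball (alpha b.1) (ratr b.2) x].

Lemma nbhs_fball (y : X) (U : set X) : nbhs y U -> exists b : nat * rat,
  [/\ 0 <= b.2, ball (alpha b.1) (ratr b.2) `<=` U &
      ball (alpha b.1) (ratr b.2) y].
Proof.
move=> /nbhs_ballP[e /= e0 eU].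
have [|b [b0 be byy]] := fball_near (X := X) y (e := e / 2).
  by rewrite divr_gt0.
exists b; split=> // z bz; apply: eU.
move: be byy bz; rewrite !ballEmdist/= => be byy bz.
have := metric_triangle y (alpha b.1) z.
by rewrite [mdist y (alpha _)]metric_sym; lra.
Qed.

(** By compactness finitely many balls with complement in [F] cover [K], and [F] is closed under
    finite intersections. *)
Lemma separating_cover K (F : set_system X) : compact K -> Filter F ->
  (forall z, K z -> exists2 U, nbhs z U & F (~` U)) ->
  exists S, [/\ all (fun b => 0 <= b.2) S, covers S K & F (~` ball_union S)].
Proof.
move=> cK FF KF.
have [z /KF[U zU FU]|S [S0 SF SK]] := @compact_fballs R X K
    (fun b => F (~` ball (alpha b.1) (ratr b.2))) cK.
  have [b [b0 bU bz]] := nbhs_fball zU; exists b; split=> //.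
  by apply: filterS FU; exact: subsetC.
exists S; split=> //; apply: filterS (filter_forall_in FF SF).
by move=> u Su [b bS bu]; exact: Su b bS bu.
Qed.

Section Attracted.
Variables (K : set X) (x : nat -> X).
Hypothesis cK : compact K.
Hypothesis Kx : forall S, all (fun b => 0 <= b.2) S -> covers S K ->
  \forall n \near \oo, ball_union S (x n).

(** A point outside [K] has a neighbourhood that misses some cover of [K], whereas the sequence
    eventually stays in that cover. *)
Lemma cluster_attracted : cluster (x n @[n --> \oo]) `<=` K.
Proof.
move=> y xy; apply: contrapT => Ky.
have [z Kz|S [S0 SK Sy]] := @separating_cover K (nbhs y) cK _.
  have zy : z != y by apply/eqP => zy; apply: Ky; rewrite -zy.
  have d0 : 0 < mdist z y / 2 by rewrite divr_gt0// mdist_gt0.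
  exists (ball z (mdist z y / 2)); first exact: nbhsx_ballx.
  apply: filterS (nbhsx_ballx y _ d0) => u yu zu.
  move: yu zu; rewrite !ballEmdist/= => yu zu.
  have := metric_triangle z u y; rewrite [mdist u _]metric_sym; lra.
by have [u [Su nSu]] := xy _ _ (Kx S0 SK) Sy.
Qed.

(** A filter on [K] together with the range, if it had no cluster point there, would avoid a whole
    cover of [K]. Only finitely many terms lie outside that cover, and the filter avoids each of
    them too. *)
Lemma compact_closure_attracted : compact (closure (range x)).
Proof.
suff cKx : compact (K `|` range x).
  apply: (subclosed_compact _ cKx); first exact: closed_closure.
  rewrite [X in _ `<=` X](closure_id _).1; last first.
    exact: compact_closed (@metric_hausdorff R X) cKx.
  by apply: closureS; exact: subsetUr.
move=> F FF FKx; apply: contrapT => nF.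
have {}nF z : (K `|` range x) z -> exists2 U, nbhs z U & F (~` U).
  move=> Kxz; apply: contrapT => nU; apply: nF; exists z; split=> //.
  move=> A B FA zB; apply: contrapT => AB; apply: nU; exists B => //.
  by apply: filterS FA => u Au Bu; apply: AB; exists u.
have [z Kz|S [S0 SK FS]] := @separating_cover K F cK _.
  by apply: nF; left.
have [N _ NS] := Kx S0 SK.
have Fx : F (fun u => forall i, i \in iota 0 N -> u != x i).
  apply: filter_forall_in => i _.
  have [|U xU FU] := nF (x i); first by right; exists i.
  by apply: filterS FU => u Uu; apply/eqP => ux; apply: Uu; rewrite ux;
    exact: nbhs_singleton.
have [u [[Ku|[i _ ix]] [Su xu]]] : exists u,
    (K `|` range x) u /\ (~` ball_union S) u /\
    forall i, i \in iota 0 N -> u != x i.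
  by apply: (@filter_ex _ F); apply: filterI FKx (filterI FS Fx).
  by apply: Su; exact: SK.
have [iN|Ni] := ltnP i N.
  by have := xu i; rewrite mem_iota iN ix eqxx => /(_ isT).
by apply: Su; rewrite -ix; exact: NS.
Qed.

End Attracted.

Section ClusterCover.
Variable x : nat -> X.
Hypothesis cx : compact (closure (range x)).
Let K := cluster (x n @[n --> \oo]).

Lemma cluster_in_closure : K `<=` closure (range x).
Proof.
move=> y xy B yB; apply: xy => //.
by exists 0%N => // n _; exists n.
Qed.

Lemma compact_cluster : compact K.
Proof.
apply: subclosed_compact cx cluster_in_closure.
rewrite /K clusterE; apply: closed_bigI => A _; exact: closed_closure.
Qed.

(** Otherwise the violating terms form a filter base [A]; its cluster point lies in [K], hence
    inside a ball of [S] with a positive margin, which the violations contradict. The factor 2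
    leaves room for the later approximation errors. *)
Lemma cover_eventually S : covers S K -> exists n, forall i, (n <= i)%N ->
  exists2 b, b \in S &
    mdist (alpha b.1) (x i) + 2 * n.+1%:R^-1 <= ratr b.2.
Proof.
move=> SK; apply: contrapT => nS.
pose A n : set X := [set y : X | exists2 i, (n <= i)%N & y = x i /\
  forall b, b \in S -> ratr b.2 < mdist (alpha b.1) (x i) + 2 * n.+1%:R^-1].
have FA : ProperFilter (filter_from setT A).
  apply: filter_from_proper => [|n _].
    apply: filter_from_filter => [|m n _ _]; first by exists 0%N.
    exists (maxn m n) => // y [i]; rewrite geq_max => /andP[mi ni] [-> Si].
    (* The index bounds both the tail and the margin; shrinking the margin strengthens a violation,
       so the sets [A n] decrease. *)
    have le k : (k <= maxn m n)%N -> (maxn m n).+1%:R^-1 <= k.+1%:R^-1 :> R.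
      by move=> km; rewrite lef_pV2 ?posrE ?ltr0n// ler_nat.
    split; exists i => //; split=> // b /Si; move/lt_le_trans; apply;
      by rewrite lerD2l ler_pM2l// le// ?leq_maxl ?leq_maxr.
  apply: contrapT => nA; apply: nS; exists n => i ni.
  apply: contrapT => nb; apply: nA; exists (x i), i => //; split=> // b bS.
  by rewrite ltNge; apply/negP => h; apply: nb; exists b.
have [|y [_ Ay]] := cx FA.
  exists 0%N => // y [i _ [-> _]]; apply: subset_closure; by exists i.
have Ky : K y.
  move=> B C [N _ NB] yC.
  have [|z [[i Ni [-> _]] Cz]] := Ay (A N) C _ yC; first by exists N.
  by exists (x i); split=> //; exact: NB.
have [b bS] := SK y Ky; rewrite ballEmdist/= => yb.
pose e : R := ratr b.2 - mdist (alpha b.1) y.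
(* One quarter bounds the distance from [y] to [x i], and two bound the margin [2 / (N + 1)]; the
   sum stays below [e]. *)
have e0 : 0 < e / 4 by rewrite divr_gt0// subr_gt0.
have [N _ /(_ N (leqnn N)) /= Ne] := near_infty_natSinv_lt (PosNum e0).
have [|z [[i _ [-> /(_ b bS) Sz]]]] := Ay (A N) _ _ (nbhsx_ballx y _ e0).
  by exists N.
rewrite ballEmdist/= => yx.
have := metric_triangle (alpha b.1) y (x i).
by move: (N.+1%:R^-1) yx Ne Sz => d; rewrite /e; lra.
Qed.

(** A cluster point is within [e] of some late term, so the uniform margin keeps it in the ball of
    that term. *)
Lemma eventually_cover S (e : R) n : 0 < e -> (forall i, (n <= i)%N ->
  exists2 b, b \in S & mdist (alpha b.1) (x i) + e <= ratr b.2) -> covers S K.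
Proof.
move=> e0 Sx y Ky.
have [|z [[b bS zb] yz]] := Ky
    [set z | exists2 b, b \in S & mdist (alpha b.1) z + e <= ratr b.2] _ _
    (nbhsx_ballx y _ e0).
  by exists n => // i; exact: Sx.
exists b => //; move: yz; rewrite !ballEmdist/= => yz.
have := metric_triangle (alpha b.1) z y; rewrite [mdist z _]metric_sym; lra.
Qed.

End ClusterCover.
End Topology.

(** * Error bounds for the approximations *)

Lemma cauchy_dist (R : realType) (X : metricType R) (alpha : nat -> X) p x m :
  cauchy_graph alpha p x -> mdist (alpha (p m)) x <= 2 ^- m.
Proof.
move=> [pm /metricType_numDomainType.cvgrPdist_lt px].
apply/ler_addgt0Pr => e e0; have [N _ Ne] := px _ e0.
have /= := Ne (N + m.+1)%N (leq_addr _ _).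
have := pm m (N + m.+1)%N (leq_addl _ _).
have := metric_triangle (alpha (p m)) (alpha (p (N + m.+1)%N)) x.
by rewrite [mdist (alpha (p (N + m.+1)%N)) x]metric_sym; lra.
Qed.

(** This is why names are read at index [n.+2]: the error is then at most a quarter of the margin
    [1 / (n + 1)]. *)
Lemma exp2_inv_le (R : realType) n : (2 : R) ^- n.+2 <= n.+1%:R^-1 / 4.
Proof.
rewrite -invfM -natrX -natrM lef_pV2 ?posrE ?ltr0n ?expn_gt0 ?muln_gt0//.
by rewrite ler_nat !expnS mulnC mulnA leq_mul2l ltn_expl.
Qed.

Section Reductions.
Variables (R : realType) (X : computableMetricSpace R) (h : nat -> nat).
Hypothesis ch : computable_nat h.
Notation alpha := (@cms_dense R X).
Hypothesis hd : forall n, cauchy_graph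
  (fun k => ratr (nuQ k) : (R^o : metricType R)) (component h n)
  (mdist (alpha (nfst n)) (alpha (nsnd n)) : R^o).

Lemma inballE n i j : inball h n i j =
  (ratr (nuQ (h (npair (npair i (nfst j)) n.+2))) + n.+1%:R^-1 <
   ratr (fball_of j).2 :> R).
Proof.
rewrite /inball /nuQ /fball_of /=; set q := h _.
move: (nfst q) (nfst (nsnd q)) (nsnd (nsnd q)) => a b c.
move: (nfst (nsnd j)) (nsnd (nsnd j)) => u v.
rewrite !(fmorph_div, rmorphB)/= !ratr_nat.
rewrite -(ltr_nat R) !natrD !natrM.
have c0 : 0 < c.+1%:R :> R by rewrite ltr0n.
have v0 : 0 < v.+1%:R :> R by rewrite ltr0n.
have n0 : 0 < n.+1%:R :> R by rewrite ltr0n.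
move: (c.+1%:R : R) (v.+1%:R : R) (n.+1%:R : R) c0 v0 n0 => C V N C0 V0 N0.
rewrite -subr_gt0 -[RHS]subr_gt0.
rewrite (_ : (u%:R / V - _) = (u%:R * C * N + b%:R * N * V -
  (a%:R * N * V + C * V)) / (C * V * N)).
  by rewrite pmulr_lgt0// invr_gt0 !mulr_gt0.
by field; rewrite !gt_eqF.
Qed.

Lemma dist_approx n i k :
  `|ratr (nuQ (h (npair (npair i k) n.+2))) - mdist (alpha i) (alpha k)| <=
    n.+1%:R^-1 / 4 :> R.
Proof.
apply: le_trans (exp2_inv_le R n).
have := cauchy_dist n.+2 (hd (npair i k)).
by rewrite !(nfst_pair, nsnd_pair) distrC.
Qed.

(** With [d = 1 / (n + 1)], the tested margin [d] loses at most the error [d / 4]. *)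
Lemma inball_sound n i j : inball h n i j ->
  mdist (alpha (nfst j)) (alpha i) + n.+1%:R^-1 * 3 / 4 < ratr (fball_of j).2.
Proof.
rewrite inballE metric_sym.
have := dist_approx n i (nfst j); rewrite ler_norml => /andP[].
by move: (n.+1%:R^-1) (ratr (nuQ _)) => d q; lra.
Qed.

(** Anything above [5 d / 4] would do; [3 d / 2] also yields the strict inequality. *)
Lemma inball_complete n i j :
  mdist (alpha (nfst j)) (alpha i) + n.+1%:R^-1 * 3 / 2 <=
    ratr (fball_of j).2 -> inball h n i j.
Proof.
rewrite inballE metric_sym.
have := dist_approx n i (nfst j); rewrite ler_norml => /andP[].
have : 0 < n.+1%:R^-1 :> R by rewrite invr_gt0 ltr0n.
by move: (n.+1%:R^-1) (ratr (nuQ _)) => d q; lra.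
Qed.

Lemma fballs_of_ge0 c : all (fun b => 0 <= b.2) (fballs_of c).
Proof.
apply/allP => b /mapP[j _ ->] /=.
by rewrite divr_ge0 ?ler0n.
Qed.

Lemma incover_sound n i c : incover h n i c -> exists2 b, b \in fballs_of c &
  mdist (alpha b.1) (alpha i) + n.+1%:R^-1 * 3 / 4 < ratr b.2.
Proof.
move=> /incoverP[j jc /inball_sound ij].
by exists (fball_of j); first exact: map_f.
Qed.

Lemma incover_complete n i c b : b \in fballs_of c ->
  mdist (alpha b.1) (alpha i) + n.+1%:R^-1 * 3 / 2 <= ratr b.2 ->
  incover h n i c.
Proof.
move=> /mapP[j jc ->] ij; apply/incoverP; exists j => //.
exact: inball_complete.
Qed.

(** * A limit-computable name of the cluster set *)

Section ClusterName.

(* A code [m = <c, n>] is a witness that the balls coded by [c] cover the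
   cluster set; [stays p t m] says that no [i < t] refutes it. *)
Definition stays (p : baire) (t m : nat) : bool :=
  all (fun i => ~~ ((nsnd m <= i)%N &&
    ~~ incover h (nsnd m) (p (npair i (nsnd m).+2)) (nfst m))) (iota 0 t).

(* Refuted witnesses are replaced by the least one that survives up to stage
   [t], because every entry of a name has to be a cover. *)
Definition cluster_name (p : baire) (z : nat) : nat :=
  nfst (if stays p (nfst z) (nsnd z) then nsnd z
        else find (stays p (nfst z)) (iota 0 (nfst z).+1)).

Lemma computable_cluster_name : computable_op cluster_name.
Proof.
apply: computable_op_fst; apply: computable_op_if; rewrite /stays;
  repeat first [computable_op_step | apply: computable_op_incover ch _ _ _].
Qed.

Variables (p : baire) (x : nat -> X).
Hypothesis px : forall i, cauchy_graph alpha (component p i) (x i).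
Hypothesis cx : compact (closure (range x)).
Let K := cluster (x n @[n --> \oo]).

Let good m := forall i, (nsnd m <= i)%N ->
  incover h (nsnd m) (p (npair i (nsnd m).+2)) (nfst m).

Lemma name_dist i n : mdist (alpha (p (npair i n.+2))) (x i) <= n.+1%:R^-1 / 4.
Proof. exact: le_trans (cauchy_dist _ (px i)) (exp2_inv_le R n). Qed.

Lemma good_covers m : good m -> covers (fballs_of (nfst m)) K.
Proof.
(* Of the margin [3 d / 4], the error [d / 4] in the name of [x i] leaves [d / 2]. *)
move=> gm; apply: (eventually_cover (e := (nsnd m).+1%:R^-1 / 2) (n := nsnd m)).
  by rewrite divr_gt0// invr_gt0 ltr0n.
move=> i /gm/incover_sound[b bm hb]; exists b => //.
move: hb (name_dist i (nsnd m)); set a := alpha (p _).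
have := metric_triangle (alpha b.1) a (x i).
by move: ((nsnd m).+1%:R^-1) => d; lra.
Qed.

Lemma covers_good c : covers (fballs_of c) K -> exists n, good (npair c n).
Proof.
move=> /(cover_eventually cx)[n nc]; exists n => i.
rewrite nfst_pair nsnd_pair => /nc[b bc hb]; apply: incover_complete bc _.
(* The margin [2 d] at [x i] becomes at least [7 d / 4] at [a], more than the required [3 d / 2]. *)
move: hb (name_dist i n); set a := alpha (p _).
have := metric_triangle (alpha b.1) (x i) a; rewrite [mdist (x i) a]metric_sym.
have : 0 < n.+1%:R^-1 :> R by rewrite invr_gt0 ltr0n.
by move: (n.+1%:R^-1) => d; lra.
Qed.

Lemma good_stays m t : good m -> stays p t m.
Proof.
move=> gm; apply/allP => i _; rewrite negb_and negbK.
by case: leqP => //= /gm.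
Qed.

Lemma bad_leaves m : ~ good m -> \forall t \near \oo, ~~ stays p t m.
Proof.
move=> /existsNP[i /not_implyP[mi /negP im]]; exists i.+1 => // t /= it.
apply/allPn; exists i; first by rewrite mem_iota.
by rewrite negbK mi.
Qed.

(** Position [m] settles on the witness [m] if it is good, and otherwise on the least good witness
    [m0], which exists because the compact set [K] has some finite cover. *)
Lemma cluster_name_lim : exists2 q, limB (cluster_name p) q &
  forall (cK : compact K), kappa_graph q (exist _ K cK).
Proof.
have exg : exists m, `[< good m >].
  have [||S [S0 _ SK]] := @compact_fballs R X K (fun=> True).
  - exact: compact_cluster.
  - by move=> y _; have [b [? ? ?]] := fball_near y ltr01; exists b.
  have [c cS] := fballs_of_surj S0.
  have [|n gn] := @covers_good c.
    by move=> y /SK[b bS yb]; exists b; rewrite ?cS.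
  by exists (npair c n); apply/asboolP.
case: (ex_minnP exg) => m0 /asboolP gm0 minm0.
exists (fun m => nfst (if `[< good m >] then m else m0)).
  move=> m; rewrite /component /cluster_name.
  have [gm|bm] := pselect (good m).
    exists 0%N => t _; rewrite nfst_pair nsnd_pair good_stays//.
    by rewrite asboolT.
  (* From [N] on, [m] and all witnesses below [m0] are refuted, and [m0] is within the search
     bound. *)
  have [N _ hN] : \forall t \near \oo, ~~ stays p t m /\
      ((m0 <= t)%N /\ forall k, k \in iota 0 m0 -> ~~ stays p t k).
    apply: filterI; first exact: bad_leaves.
    apply: filterI; first by exists m0.
    apply: filter_forall_in => k; rewrite mem_iota/= => km; apply: bad_leaves.
    by move=> /asboolP/minm0; rewrite leqNgt km.
  exists N => t /hN[nm [mt nk]]; rewrite nfst_pair nsnd_pair (negbTE nm).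
  rewrite asboolF// (@find_iota_min _ m0)//; first exact: good_stays.
  by move=> k km; apply: nk; rewrite mem_iota.
move=> cK S S0 /=; split=> [SK|[m mS]].
  have [c cS] := fballs_of_surj S0.
  have [|n gn] := @covers_good c.
    by move=> y /SK[b bS yb]; exists b; rewrite ?cS.
  by exists (npair c n) => b; rewrite asboolT// nfst_pair cS.
have : good (if `[< good m >] then m else m0) by case: asboolP.
by move=> /good_covers mK y /mK[b bm yb]; exists b; rewrite -?mS.
Qed.

End ClusterName.

Lemma BWT_le_compactChoice' : sW_le (BWT X) (derivative (compactChoice X)).
Proof.
exists (total_pfun id); eexists; split.
- exact: computable_total (computable_op_oracle computable_op_id).
- exact: computable_total computable_cluster_name.
move=> G GK p x px [y [cx xy]].
have [q qlim qK] := cluster_name_lim px cx.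
have cK := compact_cluster cx.
have [||r [z [Gr rz Kz]]] := GK (cluster_name p) (exist _ _ cK).
- by exists q => //; exact: qK.
- by exists y.
exists r, z; split=> //; exists r => //; by exists (cluster_name p).
Qed.

(** * Dense points attracted by a compact set *)

Section PointsNearLimit.

Definition candidate (p : baire) (t m a : nat) : bool :=
  all (fun l => incover h t a (p (npair t l))) (iota 0 m).

(* [t - candidate_defect p t] is the largest number of covers that a point
   [a <= t] satisfies at stage [t]. *)
Definition candidate_defect (p : baire) (t : nat) : nat :=
  find (fun k => has (candidate p t (t - k)) (iota 0 t.+1)) (iota 0 t.+1).

Definition best_point (p : baire) (t : nat) : nat :=
  find (candidate p t (t - candidate_defect p t)) (iota 0 t.+1).

(** Minimality of the defect gives [m <= t - candidate_defect p t], and a candidate for more covers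
    is one for fewer. *)
Lemma best_pointP p t m a : (m <= t)%N -> (a <= t)%N -> candidate p t m a ->
  candidate p t m (best_point p t).
Proof.
move=> mt at_ ca.
pose Q k := has (candidate p t (t - k)) (iota 0 t.+1).
have Qm : Q (t - m)%N by apply/hasP; exists a; rewrite ?mem_iota ?subKn.
have hQ : has Q (iota 0 t.+1).
  by apply/hasP; exists (t - m)%N; rewrite ?mem_iota// ltnS leq_subr.
have km : (candidate_defect p t <= t - m)%N.
  rewrite leqNgt; apply/negP => mk; have := before_find 0%N mk.
  by rewrite nth_iota ?add0n ?ltnS ?leq_subr// -/(Q _) Qm.
have : Q (candidate_defect p t).
  have := nth_find 0%N hQ; rewrite nth_iota ?add0n//.
  by move: hQ; rewrite has_find size_iota.
rewrite /Q => hc; have := nth_find 0%N hc; rewrite nth_iota ?add0n; last first.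
  by move: hc; rewrite has_find size_iota.
rewrite -/(best_point p t) => /allP hl; apply/allP => l.
rewrite mem_iota /= add0n => lm; apply: hl; rewrite mem_iota/= add0n.
by apply: leq_trans lm _; rewrite -(subKn mt) leq_sub2l.
Qed.

(** Component [t] of this output is constant, hence a Cauchy name of the dense point chosen at stage
    [t]. *)
Lemma computable_best_point :
  computable_op (fun p z => best_point p (nfst z)).
Proof.
rewrite /best_point /candidate_defect /candidate;
  repeat first [computable_op_step | apply: computable_op_incover ch _ _ _].
Qed.

Variables (p q : baire) (K : compactSet X).
Hypothesis pq : lim_graph p q.
Hypothesis qK : kappa_graph q K.
Hypothesis K0 : sval K !=set0.

Lemma name_covers l : covers (fballs_of (q l)) (sval K).
Proof. by apply/(qK (fballs_of_ge0 _)); exists l. Qed.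

(** Finitely many open covers share a neighbourhood of a point of [K], and this contains a dense
    point. *)
Lemma common_point m : exists a, forall l, (l < m)%N ->
  ball_union (X := X) (fballs_of (q l)) (alpha a).
Proof.
have [z Kz] := K0.
have : \forall y \near z, forall l, l \in iota 0 m ->
    ball_union (X := X) (fballs_of (q l)) y.
  apply: filter_forall_in => l _; have [b bl zb] := @name_covers l z Kz.
  have d0 : 0 < ratr b.2 - mdist (alpha b.1) z.
    by rewrite subr_gt0; move: zb; rewrite ballEmdist.
  apply: filterS (nbhsx_ballx z _ d0) => y zy; exists b => //.
  move: zy; rewrite !ballEmdist/= ltrBrDl; apply: le_lt_trans.
  exact: metric_triangle.
move=> /nbhs_fball[b [b0 bU bz]]; exists b.1 => l lm.
apply: bU; last by rewrite mem_iota.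
apply: ballxx; move: bz; rewrite ballEmdist/=; apply: le_lt_trans.
exact: mdist_ge0.
Qed.

(** The common point [a] has a positive margin in each of the first [m] covers. Once the
    approximations of these covers have settled and the precision is fine enough, [a] is a
    candidate, so the best point is one too. *)
Lemma near_candidate m :
  \forall t \near \oo, candidate p t m (best_point p t).
Proof.
have [a am] := common_point m.
have am' : \forall t \near \oo, forall l, l \in iota 0 m ->
    incover h t a (p (npair t l)).
  apply: filter_forall_in => l; rewrite mem_iota/= add0n => /am[b bl ab].
  have d0 : 0 < (ratr b.2 - mdist (alpha b.1) (alpha a)) / 2.
    by rewrite divr_gt0// subr_gt0; move: ab; rewrite ballEmdist.
  have [N hN] := pq l.
  have plq : \forall t \near \oo, p (npair t l) = q l by exists N.
  apply: filterS2 plq (near_infty_natSinv_lt (PosNum d0)) => t -> /= td.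
  apply: incover_complete bl _.
  by move: (t.+1%:R^-1) td => d; lra.
have mt : \forall t \near \oo, (m <= t)%N /\ (a <= t)%N.
  by apply: filterI; [exists m | exists a].
apply: filterS2 am' mt => t tm [mt at_]; apply: best_pointP mt at_ _.
exact/allP.
Qed.

Lemma best_point_attracted S : all (fun b => 0 <= b.2) S ->
  covers S (sval K) -> \forall t \near \oo,
  ball_union S (alpha (best_point p t)).
Proof.
move=> S0 /(qK S0)[l lS]; have [N hN] := pq l.
have plq : \forall t \near \oo, p (npair t l) = q l by exists N.
(* Candidates for [l.+1] are tested on the indices up to and including [l]. *)
apply: filterS2 plq (near_candidate l.+1) => t tl /allP/(_ l).
rewrite mem_iota/= add0n ltnSn => /(_ isT)/incover_sound[b].
rewrite tl lS => bS hb; exists b => //; rewrite ballEmdist/=.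
have : 0 < t.+1%:R^-1 :> R by rewrite invr_gt0 ltr0n.
by move: (t.+1%:R^-1) hb => d; lra.
Qed.

End PointsNearLimit.

Lemma compactChoice'_le_BWT : sW_le (derivative (compactChoice X)) (BWT X).
Proof.
exists (total_pfun id); eexists; split.
- exact: computable_total (computable_op_oracle computable_op_id).
- exact: computable_total computable_best_point.
move=> G GB p K [q pq qK] K0.
pose x t := alpha (best_point p t).
have Kx := best_point_attracted pq qK K0.
have cx := compact_closure_attracted (svalP K) Kx.
have [||r [y [Gr ry [_ xy]]]] := GB (fun z => best_point p (nfst z)) x.
- move=> t; split=> [m k _|].
    by rewrite /component !nfst_pair mdistxx invr_gt0 exprn_gt0.
  rewrite (_ : (fun m => _) = fun=> x t); first exact: cvg_cst.
  by apply/funext => m; rewrite /component nfst_pair.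
- by rewrite mvdom_BWT.
exists r, y; split=> //; last exact: cluster_attracted (svalP K) Kx _ xy.
by exists r => //; exists (fun z => best_point p (nfst z)).
Qed.

End Reductions.

Theorem theorem11p2 (R : realType) (X : computableMetricSpace R) :
  sW_equiv (BWT X) (derivative (compactChoice X)).
Proof.
have [h ch hd] := cms_computable X.
split; first exact: BWT_le_compactChoice' ch hd.
exact: compactChoice'_le_BWT ch hd.
Qed.
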